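(* Let $p$ be an odd prime, $f$ a positive integer, $q=p^f$, and $k$ a nonnegative integer. For a positive integer $s$ put \[ F(s)=1+(q-1)\sum_{\substack{b\in\mathbb{Z}\\ 0\le b(q-1)<sp^k}} \binom{sp^k}{ b(q-1)}. \] Let $s$ be a positive integer and let $t$ be an integer with $p^t>s$ and $f\mid k+t$. Then \[ F(s)\equiv F(p^t-s)\pmod{p^{k+2}}. \] *)

(* Defs.v *)
From mathcomp Require Import all_boot.

Set Implicit Arguments.
Unset Strict Implicit.
Unset Printing Implicit Defensive.

(* F(s) for q = p ^ f.  Since b * (q - 1) < s * p ^ k forces b < s * p ^ k as
   soon as q > 1, the range bound on b does not drop any term of the sum. *)
Definition F (p f k s : nat) : nat :=
  let q := p ^ f in
  1 + (q - 1) *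
    \sum_(0 <= b < s * p ^ k | b * (q - 1) < s * p ^ k)
      'C(s * p ^ k, b * (q - 1)).

(* Main.v *)
(* Let R be a Z/p^(k+2)-algebra, unramified in the sense that R/pR = K := F_q,
   and let teich : K -> R be the multiplicative (Teichmuller) section.  Put
   n = s p^k.  Counting with (q-1)-st roots of unity,
     F(s) = 1 + \sum_(c <> 0) (1 + teich c)^n - (q-1) [q-1 | n].
   For a = 1 + c nonzero, 1 + teich c = teich a * (1 + Z(a) / teich a), where
   Z(a) = 1 + teich (a - 1) - teich a lies in pR, so that modulo p^(k+2) the
   n-th power of the last factor is 1 + n Z(a) / teich a.  Hence
     F(s) = n \sum_(a <> 0) teich(a)^(n-1) Z(a)   in R.
   Since Z(1/a) = - Z(a) / teich a, replacing a by 1/a turns this sum for n into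
   minus the one for n' = (p^t - s) p^k, because n + n' = p^(k+t) = 1 modulo
   q - 1; and n' = -n on pR, because p^(k+t+1) = 0 in R. *)
Require Import Defs.
From mathcomp Require Import all_boot all_algebra cyclic finfield ring.
From HB Require Import structures.

Set Implicit Arguments.
Unset Strict Implicit.
Unset Printing Implicit Defensive.

Import GRing.Theory.
Local Open Scope ring_scope.

(** * Sums over the multiples of an integer *)

Lemma sum_dvdn_mul (d n : nat) (G : nat -> nat) : (0 < d)%N ->
  (\sum_(0 <= b < n | b * d < n) G (b * d) = \sum_(0 <= j < n | d %| j) G j)%N.
Proof.
move=> d_gt0; case: n => [|n]; first by rewrite !big_geq.
rewrite !big_mkord.
rewrite [RHS](reindex_onto (fun b : 'I_n.+1 => inord (b * d))
                      (fun j : 'I_n.+1 => inord (j %/ d))) /=.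
  apply: eq_big => [b|b lt_bd]; last by rewrite inordK.
  case: (ltnP (b * d) n.+1) => [lt_bd|le_bd].
    rewrite inordK // dvdn_mull // mulnK //=.
    by rewrite -val_eqE /= inordK // eqxx.
  (* If [b * d] is out of range, the round trip back to [b] would bound [b * d] by an element of
     ['I_n.+1]. *)
  apply/esym/negP => /andP [_ /eqP/(congr1 (fun i : 'I_n.+1 => i * d)%N)].
  rewrite /= inordK; last exact: leq_ltn_trans (leq_div _ _) (ltn_ord _).
  move=> eq_bd.
  have := leq_ltn_trans (leq_divM (inord (b * d) : 'I_n.+1) d) (ltn_ord _).
  by rewrite eq_bd ltnNge le_bd.
move=> j dvd_dj; apply: val_inj.
have lt_jd : (j %/ d < n.+1)%N.
  exact: leq_ltn_trans (leq_div _ _) (ltn_ord _).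
by rewrite /= (inordK lt_jd) divnK // inordK.
Qed.

(** * Gain of p-adic precision under p-th powers *)

Section PrimePowers.

Variables (R : comNzRingType) (p : nat).
Hypotheses (p_prime : prime p).

Let expr_split (y : R) n : (n <= p)%N -> y ^+ p = y ^+ (p - n) * y ^+ n.
Proof. by move=> le_np; rewrite -exprD subnK. Qed.

(** The middle binomial coefficients are divisible by [p]. The term linear in [y] is kept apart
    because it gives the first-order part in [expr1Dp_expp]. *)
Lemma exprD_prime (x y : R) : exists a,
  (x + y) ^+ p = x ^+ p + p%:R * (x ^+ p.-1 * y) + p%:R * y ^+ 2 * a + y ^+ p.
Proof.
case: p p_prime => [|[|m]] // pr.
exists (\sum_(i < m) (x ^+ (m - i) * y ^+ i) *+ ('C(m.+2, i.+2) %/ m.+2)).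
rewrite exprDn big_ord_recl big_ord_recl big_ord_recr /=.
rewrite !subSS !subn0 expr0 mulr1 bin0 bin1 mulr1n -[_ *+ m.+2]mulr_natl.
rewrite -!addrA; congr (_ + (_ + (_ + _))); last first.
  by rewrite /bump /= !add1n subnn mul1r binn.
rewrite mulr_sumr; apply: eq_bigr => i _; rewrite /bump /= !add1n !subSS.
have dvd_bin : (m.+2 %| 'C(m.+2, i.+2))%N.
  by apply: prime_dvd_bin => //; rewrite !ltnS ltn_ord.
rewrite -[in LHS](divnK dvd_bin) -!(mulr_natr (_ * _)) natrM.
by rewrite !exprS expr0; ring.
Qed.

(** Each p-th power gains a factor [p]: the mixed terms carry one explicitly, and the last term is
    divisible by p^(2j+2), as p >= 2. *)
Lemma exprDp_expp (x w : R) (j : nat) : exists v,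
  (x + p%:R * w) ^+ (p ^ j) = x ^+ (p ^ j) + p%:R ^+ j.+1 * v.
Proof.
elim: j => [|j [v IH]]; first by exists w; rewrite !expn0 !expr1.
rewrite !expnSr !exprM IH.
have [a ->] := exprD_prime (x ^+ (p ^ j)) (p%:R ^+ j.+1 * v).
have -> : (p%:R ^+ j.+1 * v) ^+ p =
    p%:R ^+ j.+2 * (p%:R ^+ j * v ^+ 2 * (p%:R ^+ j.+1 * v) ^+ (p - 2)).
  rewrite (expr_split _ (prime_gt1 p_prime)).
  by move: (_ ^+ (p - 2)) => u; rewrite !exprS expr0; ring.
exists (x ^+ (p ^ j) ^+ p.-1 * v + p%:R ^+ j.+1 * v ^+ 2 * a +
  p%:R ^+ j * v ^+ 2 * (p%:R ^+ j.+1 * v) ^+ (p - 2)).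
move: (_ ^+ (p - 2)) (_ ^+ p.-1) (_ ^+ p) => u1 u2 u3.
by rewrite !exprS expr0; ring.
Qed.

Lemma expr1Dp_expp (w : R) (k : nat) : odd p -> exists v,
  (1 + p%:R * w) ^+ (p ^ k) = 1 + p%:R ^+ k.+1 * w + p%:R ^+ k.+2 * v.
Proof.
move=> p_odd; elim: k => [|k [v IH]].
  by exists 0; rewrite expn0 !expr1 mulr0 addr0.
rewrite expnSr exprM IH -addrA.
have p_gt2 : (2 < p)%N by rewrite odd_prime_gt2.
set y := p%:R ^+ k.+1 * w + p%:R ^+ k.+2 * v.
have [a ->] := exprD_prime 1 y.
have yE : y = p%:R ^+ k.+1 * (w + p%:R * v) by rewrite /y !exprS; ring.
(* Oddness matters here: p >= 3 makes y^p divisible by p^(3k+3), whereas p = 2 and k = 0 would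
   guarantee only p^2 instead of p^3. *)
have -> : y ^+ p = p%:R ^+ k.+3 *
    (p%:R ^+ k * p%:R ^+ k * (w + p%:R * v) ^+ 3 * y ^+ (p - 3)).
  rewrite (expr_split y p_gt2); move: (_ ^+ (p - 3)) => u.
  by rewrite yE !exprS expr0; ring.
rewrite !expr1n mul1r [in p%:R * y]/y.
exists (v + p%:R ^+ k * (w + p%:R * v) ^+ 2 * a +
   p%:R ^+ k * p%:R ^+ k * (w + p%:R * v) ^+ 3 * y ^+ (p - 3)).
by rewrite yE !exprS expr0; ring.
Qed.

End PrimePowers.

(** * The cyclic group of nonzero elements of a finite field *)

Lemma finField_expr_pred_card (K : finFieldType) (x : K) :
  x != 0 -> x ^+ #|K|.-1 = 1.
Proof.
move=> x_neq0; apply: (mulfI x_neq0).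
by rewrite -exprS prednK ?expf_card ?mulr1 // ltnW ?finNzRing_gt1.
Qed.

Lemma finField_expr_card_exp (K : finFieldType) (x : K) m :
  x ^+ (#|K| ^ m) = x.
Proof.
by elim: m => [|m IH]; rewrite ?expn0 ?expr1 // expnS exprM expf_card.
Qed.

Lemma finField_prim_root (K : finFieldType) :
  exists g : K, #|K|.-1.-primitive_root g.
Proof.
have K_gt1 : (1 < #|K|)%N := finNzRing_gt1 K.
have /hasP [g _ g_prim] : has #|K|.-1.-primitive_root (enum (predC1 (0 : K))).
  apply: has_prim_root; rewrite ?enum_uniq // -?cardE ?cardC1 //.
    by rewrite -ltnS prednK // ltnW.
  apply/allP => x; rewrite mem_enum inE /= unity_rootE => x_neq0.
  exact/eqP/finField_expr_pred_card.
by exists g.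
Qed.

(** * The Teichmuller section and the power sums that express [F] *)

Section Teichmuller.

Variables (R : comNzRingType) (K : finFieldType) (pi : {rmorphism R -> K}).
Variables (p f N : nat).
Hypotheses (p_prime : prime p) (p_odd : odd p) (card_K : #|K| = (p ^ f)%N).
Hypothesis pN_eq0 : p%:R ^+ N = 0 :> R.
Hypothesis pi_surj : forall a : K, exists r, pi r == a.
Hypothesis pi_ker : forall r, pi r = 0 -> exists w, r = p%:R * w.

(** The exponent is a power of q, hence acts as the identity on [K]; with [f * N >= N] it is also
    large enough to erase the choice of lift. *)
Definition teich (a : K) : R := xchoose (pi_surj a) ^+ (p ^ (f * N)).

Let f_gt0 : (0 < f)%N.
Proof. by have := finNzRing_gt1 K; rewrite card_K; case: f. Qed.

(** Two lifts of the same element differ by a multiple of [p], so their powers agree modulo p^(f * N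
    + 1), which is zero in [R]. *)
Lemma expr_teich r : r ^+ (p ^ (f * N)) = teich (pi r).
Proof.
have [|w rE] := pi_ker (r := r - xchoose (pi_surj (pi r))).
  by rewrite rmorphB /= (eqP (xchooseP (pi_surj (pi r)))) subrr.
rewrite /teich -[r in LHS](subrK (xchoose (pi_surj (pi r)))) rE addrC.
have [v ->] := exprDp_expp p_prime (xchoose (pi_surj (pi r))) w (f * N).
have le_N : (N <= (f * N).+1)%N by rewrite leqW // leq_pmull.
by rewrite -(subnK le_N) exprD pN_eq0 mulr0 mul0r addr0.
Qed.

Lemma pi_teich a : pi (teich a) = a.
Proof.
rewrite rmorphXn /= (eqP (xchooseP (pi_surj a))) expnM -card_K.
exact: finField_expr_card_exp.
Qed.

Lemma teichM a b : teich (a * b) = teich a * teich b.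
Proof.
have teichK c : teich c ^+ (p ^ (f * N)) = teich c.
  by rewrite expr_teich pi_teich.
by rewrite -(teichK a) -(teichK b) -exprMn expr_teich rmorphM /= !pi_teich.
Qed.

Lemma teich1 : teich 1 = 1.
Proof. by rewrite -(rmorph1 pi) -expr_teich expr1n. Qed.

Lemma teich0 : teich 0 = 0.
Proof.
by rewrite -(rmorph0 pi) -expr_teich expr0n expn_eq0 -leqn0 leqNgt prime_gt0.
Qed.

Lemma teichN a : teich (- a) = - teich a.
Proof.
rewrite -mulN1r teichM -(rmorphN1 pi) -expr_teich -signr_odd oddX p_odd orbT.
by rewrite expr1 mulN1r.
Qed.

Lemma teichX a j : teich (a ^+ j) = teich a ^+ j.
Proof.
by elim: j => [|j IH]; rewrite ?expr0 ?teich1 // !exprS teichM IH.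
Qed.

Lemma teichVr a : a != 0 -> teich a^-1 * teich a = 1.
Proof. by move=> a_neq0; rewrite -teichM mulVf ?teich1. Qed.

(** Orthogonality: multiplication by a generator [g] permutes the nonzero elements, so 1 -
    teich(g)^j annihilates the sum. *)
Lemma sum_teichX j : \sum_(c | c != 0) teich c ^+ j =
  if (#|K|.-1 %| j)%N then #|K|.-1%:R else 0.
Proof.
have [g g_prim] := finField_prim_root K.
case: ifP => [dvd_j | ndvd_j].
  rewrite (eq_bigr (fun=> 1)) => [|c c_neq0].
    by rewrite sumr_const cardC1.
  rewrite -teichX -(divnK dvd_j) mulnC exprM.
  by rewrite finField_expr_pred_card // expr1n teich1.
have g_neq0 : g != 0.
  apply: contraTneq g_prim => ->.
  apply/negP => /[dup]/prim_expr_order/eqP + /prim_order_gt0.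
  by case: #|K|.-1 => // m; rewrite expr0n eq_sym oner_eq0.
set S := \sum_(c | _) _.
have gS : teich g ^+ j * S = S.
  rewrite mulr_sumr [RHS](reindex_onto ( *%R g) ( *%R g^-1)) /=; last first.
    by move=> c _; rewrite mulVKf.
  apply: eq_big => [c | c _]; last by rewrite teichM exprMn.
  by rewrite mulf_eq0 negb_or g_neq0 mulKf // eqxx andbT.
have u_neq0 : 1 - g ^+ j != 0.
  by rewrite subr_eq0 eq_sym -(prim_order_dvd g_prim) ndvd_j.
have e_gt0 : (0 < p ^ (f * N))%N by rewrite expn_gt0 prime_gt0.
(* [R] carries no inverse operation. Raised to this power, the annihilator becomes the Teichmuller
   lift of the nonzero 1 - g^j, which [teichVr] inverts. *)
have rS : (1 - teich g ^+ j) ^+ (p ^ (f * N)) * S = 0.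
  by rewrite -(prednK e_gt0) exprSr -mulrA mulrBl mul1r gS subrr mulr0.
rewrite expr_teich rmorphB rmorph1 rmorphXn /= pi_teich in rS.
by rewrite -[S]mul1r -(teichVr u_neq0) -mulrA rS mulr0.
Qed.

(* Z(a) in the introduction. *)
Definition teich_defect a := 1 + teich (a - 1) - teich a.

Lemma teich_defect_ker a : exists w, teich_defect a = p%:R * w.
Proof.
apply: pi_ker; rewrite /teich_defect rmorphB rmorphD rmorph1 /= !pi_teich.
by rewrite [1 + _]addrC subrK subrr.
Qed.

(** The left side is teich(a) + teich(1 - a) - 1, and [teich] is odd. *)
Lemma teich_defectV a : a != 0 ->
  teich a * teich_defect a^-1 = - teich_defect a.
Proof.
move=> a_neq0; rewrite /teich_defect !mulrDr mulrN -!teichM mulrBr !mulr1.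
by rewrite mulfV // teich1 -[1 - a]opprB teichN; ring.
Qed.

Lemma expr_1Dteich a (k s : nat) : N = (k + 2)%N -> (0 < s)%N -> a != 0 ->
  (1 + teich (a - 1)) ^+ (s * p ^ k) =
  teich a ^+ (s * p ^ k)
  + (s * p ^ k)%:R * (teich a ^+ (s * p ^ k).-1 * teich_defect a).
Proof.
move=> NE s_gt0 a_neq0.
have n_gt0 : (0 < s * p ^ k)%N by rewrite muln_gt0 s_gt0 expn_gt0 prime_gt0.
have [w wE] := teich_defect_ker a.
have -> : 1 + teich (a - 1) = teich a * (1 + p%:R * (teich a^-1 * w)).
  rewrite [p%:R * _]mulrCA -wE mulrDr mulr1 mulrA [teich a * _]mulrC.
  by rewrite teichVr // mul1r /teich_defect; ring.
have -> : (teich a * (1 + p%:R * (teich a^-1 * w))) ^+ (s * p ^ k) =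
    teich a ^+ (s * p ^ k) * (1 + p%:R * (teich a^-1 * w)) ^+ (p ^ k) ^+ s.
  by rewrite exprMn -exprM [(p ^ k * s)%N]mulnC.
have [v ->] := expr1Dp_expp p_prime (teich a^-1 * w) k p_odd.
rewrite -addn2 -NE pN_eq0 mul0r addr0.
set y := p%:R ^+ k.+1 * _.
have yy : y * y = 0.
  have -> : y * y = p%:R ^+ N * (p%:R ^+ k * (teich a^-1 * w) ^+ 2).
    by rewrite NE addn2 /y !exprS expr0; ring.
  by rewrite pN_eq0 mul0r.
have -> : (1 + y) ^+ s = 1 + s%:R * y.
  elim: (s) => [|m IH]; first by rewrite expr0 mul0r addr0.
  rewrite exprS IH mulrDl mul1r mulrDr mulr1 [y * _]mulrCA yy mulr0 addr0.
  by rewrite -natr1; ring.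
rewrite mulrDr mulr1 wE -[in X in X * (s%:R * _)](prednK n_gt0) exprSr.
congr (_ + _); rewrite natrM natrX /y exprSr.
transitivity (s%:R * p%:R ^+ k * (teich a ^+ (s * p ^ k).-1 *
   (p%:R * w)) * (teich a^-1 * teich a)); first by ring.
by rewrite teichVr ?mulr1.
Qed.

Lemma natr_F (k s : nat) : N = (k + 2)%N -> (0 < s)%N ->
  (F p f k s)%:R =
  (s * p ^ k)%:R *
  \sum_(a | a != 0) teich a ^+ (s * p ^ k).-1 * teich_defect a.
Proof.
move=> NE s_gt0.
have n_gt0 : (0 < s * p ^ k)%N by rewrite muln_gt0 s_gt0 expn_gt0 prime_gt0.
have q_gt0 : (0 < #|K|.-1)%N by rewrite -subn1 subn_gt0 finNzRing_gt1.
rewrite /F -card_K subn1 sum_dvdn_mul // natrD natrM natr_sum.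
set n := (s * p ^ k)%N in n_gt0 *.
(* After exchanging the sums, orthogonality keeps the exponents divisible by q - 1; the top one, j =
   n, is split off because [F] omits it. *)
have sum1D : \sum_(c | c != 0) (1 + teich c) ^+ n =
    #|K|.-1%:R * \sum_(0 <= j < n | (#|K|.-1 %| j)%N) 'C(n, j)%:R +
    \sum_(c | c != 0) teich c ^+ n.
  under eq_bigr => c _ do rewrite exprDn.
  rewrite exchange_big /= big_ord_recr /=; congr (_ + _); last first.
    by apply: eq_bigr => c _; rewrite subnn mul1r binn.
  rewrite big_mkord mulr_sumr [RHS]big_mkcond /=; apply: eq_bigr => j _.
  rewrite sumrMnl /= (eq_bigr (fun c => teich c ^+ j)); last first.
    by move=> c _; rewrite expr1n mul1r.
  by rewrite sum_teichX; case: ifP; rewrite ?mul0rn // mulr_natr.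
(* With c = a - 1, the leading 1 of [F] is the term a = 1, and a = 0 contributes 0^n = 0 because n >
   0. *)
have shift : 1 + \sum_(c | c != 0) (1 + teich c) ^+ n =
    \sum_(a | a != 0) (1 + teich (a - 1)) ^+ n.
  rewrite [in LHS](reindex_onto (fun a => a - 1) (fun c => c + 1)) /=;
    last by move=> c _; rewrite addrK.
  transitivity (\sum_a (1 + teich (a - 1)) ^+ n).
    rewrite [RHS](bigD1 (1 : K)) //= subrr teich0 addr0 expr1n; congr (_ + _).
    by apply: eq_bigl => a; rewrite subrK eqxx andbT subr_eq0.
  rewrite (bigD1 (0 : K)) //= sub0r teichN teich1 subrr expr0n.
  by rewrite -leqn0 leqNgt n_gt0 add0r.
rewrite -[X in 1 + X](addrK (\sum_(c | c != 0) teich c ^+ n)) -sum1D addrA shift.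
(* The leading terms teich(a)^n in [expr_1Dteich] cancel the top sum split off above. *)
rewrite -sumrB mulr_sumr; apply: eq_bigr => a a_neq0.
by rewrite expr_1Dteich // addrC addKr.
Qed.

Lemma natr_F_sym (k s t : nat) : N = (k + 2)%N -> (0 < s)%N ->
  (s < p ^ t)%N -> (f %| k + t)%N ->
  (F p f k s)%:R = (F p f k (p ^ t - s))%:R :> R.
Proof.
move=> NE s_gt0 s_lt dvd_f; have s'_gt0 : (0 < p ^ t - s)%N by rewrite subn_gt0.
rewrite !natr_F // [in RHS](reindex_onto (@GRing.inv K) (@GRing.inv K)) /=;
  last by move=> a _; rewrite invrK.
rewrite !mulr_sumr [in RHS](eq_bigl (fun a => a != 0)); last first.
  by move=> a; rewrite invr_eq0 invrK eqxx andbT.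
apply: eq_bigr => a a_neq0.
set n := (s * p ^ k)%N; set n' := ((p ^ t - s) * p ^ k)%N.
have n_gt0 : (0 < n)%N by rewrite muln_gt0 s_gt0 expn_gt0 prime_gt0.
have n'_gt0 : (0 < n')%N by rewrite muln_gt0 s'_gt0 expn_gt0 prime_gt0.
have nn' : (n + n' = p ^ (k + t))%N.
  by rewrite -mulnDl subnKC ?(ltnW s_lt) // -expnD addnC.
(* With t >= 1 the exponent k + t + 1 reaches N = k + 2, so that p^(k+t+1) vanishes in [R]. *)
have t_gt0 : (0 < t)%N.
  rewrite lt0n; apply: contraTneq s_lt => ->.
  by rewrite expn0 ltnS leqNgt s_gt0.
have aE : a ^+ n.-1 * a ^+ n' = 1.
  apply: (mulfI a_neq0); rewrite mulrA -exprS prednK // -exprD nn' mulr1.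
  case/dvdnP: dvd_f => m ->.
  by rewrite mulnC expnM -card_K finField_expr_card_exp.
have taE : teich a ^+ n.-1 = teich a^-1 ^+ n'.
  rewrite -!teichX; congr teich; apply: (mulIf (expf_neq0 n' a_neq0)).
  by rewrite aE exprVn mulVf // expf_neq0.
have [w wE] := teich_defect_ker a.
have n'E : n'%:R * teich_defect a = - (n%:R * teich_defect a).
  apply/eqP; rewrite -addr_eq0 -mulrDl addrC -natrD nn' natrX wE mulrA -exprSr.
  have le_N : (N <= (k + t).+1)%N by rewrite NE -addnS leq_add2l.
  by rewrite -(subnK le_N) exprD pN_eq0 mulr0 mul0r.
have E : n%:R * teich_defect a = n'%:R * (teich a * teich_defect a^-1).
  by rewrite teich_defectV // mulrN n'E opprK.
rewrite taE -[in LHS](prednK n'_gt0) exprSr mulrCA !mulrA -mulrA E.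
move: (_ ^+ n'.-1) => u.
transitivity (n'%:R * (u * teich_defect a^-1) * (teich a^-1 * teich a)).
  by ring.
by rewrite teichVr // mulr1 mulrA.
Qed.

End Teichmuller.

(** * Construction of an unramified ring surjecting onto [K] *)

Section UnramifiedLift.

Variables (A : finComUnitRingType) (K : finFieldType).
Variables (phi : {rmorphism A -> K}) (p : nat).
Hypothesis phi_unit : forall a, phi a != 0 -> a \is a GRing.unit.
Hypothesis phi_ker : forall a, phi a = 0 -> exists b, a = p%:R * b.

Lemma map_poly_eq0_natr (q : {poly A}) :
  map_poly phi q = 0 -> exists q', q = p%:R * q'.
Proof.
elim/poly_ind: q => [|q c IH]; first by exists 0; rewrite mulr0.
rewrite rmorphD rmorphM /= map_polyX map_polyC /= => qc_eq0.
have c_eq0 : phi c = 0.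
  by have /polyP/(_ 0%N) := qc_eq0; rewrite coefD coefMX coefC coef0 add0r.
have [|q' ->] := IH.
  apply/polyP => i; have /polyP/(_ i.+1) := qc_eq0.
  by rewrite coefD coefMX coefC addr0 !coef0.
have [b ->] := phi_ker c_eq0.
by exists (q' * 'X + b%:P); rewrite rmorphM /= rmorph_nat mulrDr mulrA.
Qed.

Variable g : K.

(* The size-minimal h is a lift of the minimal polynomial of g over F_p; its
   minimality alone makes pR the kernel of A[X]/(h) -> K, so irreducibility of
   the reduction of h is never needed. *)
Lemma exists_minimal_monic : exists h : {poly A},
  [/\ h \is monic, root (map_poly phi h) g &
    forall q : {poly A}, q \is monic -> root (map_poly phi q) g ->
      (size h <= size q)%N].
Proof.
(* Finiteness of [A] makes [P] decidable, so a least n exists; X^q - X with q = #|K| shows that some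
   n works. *)
pose P n := [exists h : {poly_n A},
  (val h \is monic) && root (map_poly phi (val h)) g].
have PE (q : {poly A}) : q \is monic -> root (map_poly phi q) g -> P (size q).
  move=> q_monic q_root; apply/existsP; exists (npolyp (size q) q).
  by rewrite /= npolypK // q_monic.
have exP : exists n, P n.
  exists (size ('X^#|K| - 'X : {poly A})); apply: PE.
    rewrite monicE lead_coefDl ?lead_coefXn // size_polyN size_polyX size_polyXn.
    by rewrite ltnS finNzRing_gt1.
  by rewrite rmorphB /= map_polyXn map_polyX rootE !hornerE expf_card subrr.
case: (ex_minnP exP) => n /existsP [h /andP [h_monic h_root]] n_min.
exists (val h); split=> // q q_monic q_root.
by apply: leq_trans (size_npoly h) _; exact: n_min (PE q q_monic q_root).
Qed.

(** If the reduction of [q] had size d > 0, cutting [q] at d and dividing by the unit [u] would give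
    a monic polynomial, shorter than [h], whose reduction has root [g]. So the reduction is zero. *)
Lemma minimal_monic_ker (h q : {poly A}) :
  (forall q : {poly A}, q \is monic -> root (map_poly phi q) g ->
      (size h <= size q)%N) ->
  (size q < size h)%N -> root (map_poly phi q) g -> exists q', q = p%:R * q'.
Proof.
move=> h_min lt_qh q_root; apply: map_poly_eq0_natr; apply/eqP.
rewrite -size_poly_leq0 leqNgt; apply/negP => q_gt0.
set d := size (map_poly phi q) in q_gt0.
have le_d : (d <= size q)%N := size_poly _ _.
pose u := q`_d.-1.
have phi_u : phi u = lead_coef (map_poly phi q) by rewrite lead_coefE coef_map.
have u_unit : u \is a GRing.unit.
  by apply: phi_unit; rewrite phi_u lead_coef_eq0 -size_poly_gt0.
pose r := u^-1 *: take_poly d q.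
have size_r : (size r <= d)%N.
  exact: leq_trans (size_scale_leq _ _) (size_take_poly _ _).
have r_top : r`_d.-1 = 1.
  by rewrite coefZ coef_take_poly prednK // leqnn mulVr.
have size_rE : size r = d.
  apply/eqP; rewrite eqn_leq size_r -(prednK q_gt0) ltnNge.
  by apply/negP => /leq_sizeP/(_ _ (leqnn _))/eqP; rewrite r_top oner_eq0.
have r_monic : r \is monic by rewrite monicE lead_coefE size_rE r_top.
have r_root : root (map_poly phi r) g.
  suff -> : map_poly phi r = phi u^-1 *: map_poly phi q.
    by rewrite rootE hornerZ (rootP q_root) mulr0.
  apply/polyP => i; rewrite coefZ !coef_map coefZ /= rmorphM coef_take_poly.
  by case: ltnP => // le_di; rewrite -coef_map [in RHS]nth_default // rmorph0.
have := h_min r r_monic r_root.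
by rewrite size_rE leqNgt (leq_ltn_trans le_d lt_qh).
Qed.

Hypothesis g_prim : #|K|.-1.-primitive_root g.

(** The ring is A[X]/(h), mapped to [K] by X -> g; powers of the primitive root give surjectivity.
    The last clause lets equalities of integers return from [R] to [A]. *)
Lemma exists_unramified_lift :
  exists (R : comNzRingType) (pi : {rmorphism R -> K}),
  [/\ forall a, exists r, pi r == a,
      forall r, pi r = 0 -> exists w, r = p%:R * w
    & forall m, (m%:R == 0 :> R) = (m%:R == 0 :> A)].
Proof.
have [h [h_monic h_root h_min]] := exists_minimal_monic.
have h_gt1 : (1 < size h)%N.
  rewrite ltnNge; apply/negP => /size1_polyC hE.
  move: h_monic h_root; rewrite hE monicE lead_coefC => /eqP ->.
  by rewrite map_polyC /= rmorph1 rootC oner_eq0.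
(* [mk_monic] falls back to X unless its argument is monic of size above 1. *)
have hE : mk_monic h = h by rewrite /mk_monic h_gt1 h_monic.
pose ev (q : {poly A}) := (map_poly phi q).[g].
have evM q r : ev (q * r) = ev q * ev r by rewrite /ev rmorphM hornerM.
have ev_mod q : ev (Pdiv.CommonRing.rmodp q h) = ev q.
  rewrite [in RHS](Pdiv.RingMonic.rdivp_eq h_monic q).
  by rewrite /ev rmorphD rmorphM hornerD hornerM (rootP h_root) mulr0 add0r.
pose pi (q : {poly %/ h}) := ev q.
have pi_in q : pi (in_qpoly h q) = ev q by rewrite /pi /= hE ev_mod.
have piB : zmod_morphism pi.
  by move=> q r; rewrite /pi /ev /= rmorphB hornerD hornerN.
have pi_mon : monoid_morphism pi.
  split; first by rewrite /pi /ev /= rmorph1 hornerC.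
  by move=> q r; rewrite -evM -pi_in.
pose pi' : {rmorphism {poly %/ h} -> K} :=
  HB.pack pi (GRing.isZmodMorphism.Build _ _ pi piB)
             (GRing.isMonoidMorphism.Build _ _ pi pi_mon).
exists {poly %/ h}, pi'; split=> [a|r pi_r|m].
- have [->|a_neq0] := eqVneq a 0; first by exists 0; rewrite rmorph0.
  have [i ->] := prim_rootP g_prim (finField_expr_pred_card a_neq0).
  by exists (in_qpoly h 'X^i); rewrite /= pi_in /ev map_polyXn hornerXn.
- have [||q' rE] := minimal_monic_ker (q := val r) h_min.
  + by apply: leq_trans (size_mk_monic r) _; rewrite hE.
  + exact/eqP.
  exists (in_qpoly h q'); rewrite -(rmorph_nat (in_qpoly h)) -rmorphM -rE.
  by apply/esym/val_inj; exact: in_qpoly_small (size_mk_monic r).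
by rewrite -val_eqE /= qpolyC_natr -polyC_natr polyC_eq0.
Qed.

End UnramifiedLift.

(** * Reduction of the integers modulo p^N into [K] *)

Lemma exists_Zp_morphism (K : finFieldType) (p N : nat) :
  prime p -> (0 < N)%N -> p%:R = 0 :> K ->
  exists phi : {rmorphism 'Z_(p ^ N) -> K},
    (forall a, phi a != 0 -> a \is a GRing.unit)
    /\ (forall a, phi a = 0 -> exists b, a = p%:R * b).
Proof.
move=> p_prime N_gt0 pK_eq0.
have pN_gt1 : (1 < p ^ N)%N.
  by rewrite -(exp1n N) ltn_exp2r // prime_gt1.
have p_char : p \in [pchar K] by rewrite inE p_prime pK_eq0 eqxx.
pose phi (a : 'Z_(p ^ N)) : K := (a : nat)%:R.
(* Independence of the representative, since p^N = 0 in [K]; the other properties are then read off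
   on naturals. *)
have phi_nat m : phi m%:R = m%:R.
  rewrite /phi val_Zp_nat // [in RHS](divn_eq m (p ^ N)) natrD natrM natrX.
  by rewrite pK_eq0 expr0n gtn_eqF // mulr0 add0r.
have phiD a b : phi (a + b) = phi a + phi b.
  by rewrite -[a in LHS]natr_Zp -[b in LHS]natr_Zp -natrD phi_nat natrD.
have phiB : zmod_morphism phi.
  by move=> a b; apply/eqP; rewrite eq_sym subr_eq -phiD subrK.
have phi_mon : monoid_morphism phi.
  split; first by rewrite -[1]/(1%:R) phi_nat.
  move=> a b; rewrite -[a in LHS]natr_Zp -[b in LHS]natr_Zp -natrM.
  by rewrite phi_nat natrM.
pose phi' : {rmorphism 'Z_(p ^ N) -> K} :=
  HB.pack phi (GRing.isZmodMorphism.Build _ _ phi phiB)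
              (GRing.isMonoidMorphism.Build _ _ phi phi_mon).
exists phi'.
split=> a /=; rewrite -[a]natr_Zp phi_nat.
  rewrite unitZpE // coprime_pexpl // prime_coprime //.
  by rewrite (dvdn_pcharf p_char).
move/eqP; rewrite -(dvdn_pcharf p_char) => /dvdnP [m ->].
by exists m%:R; rewrite mulnC natrM.
Qed.

Local Close Scope ring_scope.

(** * Descent from the unramified ring to a congruence of integers *)

Theorem theorem1p5 (p f k s t : nat)
  (p_prime : prime p) (p_odd : odd p) (f_gt0 : 0 < f) (s_gt0 : 0 < s)
  (s_lt_pt : s < p ^ t) (f_dvd : f %| k + t) :
  F p f k s = F p f k (p ^ t - s) %[mod p ^ (k + 2)].
Proof.
have pN_gt1 : 1 < p ^ (k + 2).
  apply: leq_trans (prime_gt1 p_prime) _.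
  by rewrite addn2 expnS leq_pmulr // expn_gt0 prime_gt0.
have [K p_char card_K] := pPrimePowerField p_prime f_gt0.
have pK_eq0 : (p%:R = 0 :> K)%R by exact: pcharf0.
have N_gt0 : 0 < k + 2 by rewrite addn2.
have [phi [phi_unit phi_ker]] := exists_Zp_morphism p_prime N_gt0 pK_eq0.
have [g g_prim] := finField_prim_root K.
have [R [pi [pi_surj pi_ker natr_eq0]]] :=
  exists_unramified_lift phi_unit phi_ker g_prim.
have pN_eq0 : (p%:R ^+ (k + 2) = 0 :> R)%R.
  by apply/eqP; rewrite -natrX natr_eq0 pchar_Zp.
have := natr_F_sym p_prime p_odd card_K pN_eq0 pi_surj pi_ker (erefl _)
  s_gt0 s_lt_pt f_dvd.
set m := F p f k s; set m' := F p f k _; move=> eq_R.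
suff : (m%:R == m'%:R :> 'Z_(p ^ (k + 2)))%R.
  by move/eqP/(congr1 val); rewrite /= !val_Zp_nat.
(* [natr_eq0] only detects vanishing, so the equality is rephrased through a difference of naturals,
   which requires ordering [m] and [m']. *)
wlog le_m : m m' eq_R / m <= m' => [H|].
  by have [/H->|/ltnW/H] := leqP m m'; rewrite // eq_sym; apply.
by rewrite eq_sym -subr_eq0 -natrB // -natr_eq0 natrB // eq_R subrr.
Qed.
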